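(* Let $V=\mathbb{R}^4$ with standard basis $a_1,\dots,a_4$ and standard inner product, and let $\lambda,\mu$ be positive real numbers with $\mu \le \lambda \le 2\mu$. Let $$P_{\lambda,\mu}= \bigcap_{i} \{ x : \langle \pm a_i, x \rangle \le \mu \} \cap \{x: \langle \pm a_1 \pm a_2 \pm a_3 \pm a_4, x \rangle \le 2 \mu\} \cap \bigcap_{i<j} \{x: \langle \pm a_i \pm a_j, x \rangle \le \lambda\}$$ (all sign choices). Then: (1) If $\frac{4}{3}\mu \le \lambda \le \frac{3}{2}\mu$, then $P_{\lambda,\mu}$ has a generating set of $12$ elements. (2) If $\mu \le \lambda \le \frac{4}{3}\mu$ or $\frac{3}{2}\mu \le \lambda \le 2\mu$, then $P_{\lambda,\mu}$ has a generating set of $24$ elements. Moreover, if the inequalities between $\lambda$ and $\mu$ in the respective case are strict (i.e. $\frac{4}{3}\mu < \lambda < \frac{3}{2}\mu$ in case (1), and $\mu < \lambda < \frac{4}{3}\mu$ or $\frac{3}{2}\mu < \lambda < 2\mu$ in case (2)), then $12$, respectively $24$, is the minimum possible size of a generating set of $P_{\lambda,\mu}$.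
   Context: $\Phi = \{\pm a_i\} \cup \{\pm a_i \pm a_j : i<j\} \cup \{\tfrac12(\pm a_1 \pm a_2 \pm a_3 \pm a_4)\}$ is a root system of type $F_4$ in $\mathbb{R}^4$; the sets $P_{\lambda,\mu}$ with $\mu\le\lambda\le2\mu$ are exactly the alcoved polytopes of type $F_4$ invariant under its Weyl group. An alcoved polytope of type $F_4$ is a bounded set $\bigcap_{a\in\Psi}\{x:\langle a,x\rangle\le c_a\}$ with $\Psi\subseteq\Phi$, $c_a\in\mathbb{R}$. A subset $\Sigma\subseteq\mathbb{R}^4$ is a generating set of $P_{\lambda,\mu}$ if $P_{\lambda,\mu}$ is the smallest alcoved polytope of type $F_4$ containing $\Sigma$. *)

(* Defs.v *)
From HB Require Import structures.
From mathcomp Require Import all_boot all_order all_algebra.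
From mathcomp Require Import all_classical all_reals all_analysis.

Set Implicit Arguments.
Unset Strict Implicit.
Unset Printing Implicit Defensive.

Import Order.TTheory GRing.Theory Num.Theory.
Import numFieldNormedType.Exports.

Local Open Scope classical_set_scope.
Local Open Scope card_scope.
Local Open Scope ring_scope.

Section F4.
Variable R : realType.

Definition dotv (u v : 'rV[R]_4) : R := \sum_(i < 4) u 0 i * v 0 i.

Definition stdb (i : 'I_4) : 'rV[R]_4 := delta_mx 0 i.

(* The sign choices are booleans: (-1) ^+ s is -1 if s holds and 1 otherwise. *)
Definition F4_short1 : set 'rV[R]_4 :=
  [set v | exists (s : bool) (i : 'I_4), v = (-1) ^+ s *: stdb i].

Definition F4_long : set 'rV[R]_4 :=
  [set v | exists (s t : bool) (i j : 'I_4),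
     (i < j)%N /\ v = (-1) ^+ s *: stdb i + (-1) ^+ t *: stdb j].

Definition F4_short4 : set 'rV[R]_4 :=
  [set v | exists s : 'I_4 -> bool,
     v = 2^-1 *: \sum_(i < 4) (-1) ^+ (s i) *: stdb i].

Definition F4_roots : set 'rV[R]_4 := F4_short1 `|` F4_long `|` F4_short4.

Definition alcoved (Q : set 'rV[R]_4) : Prop :=
  bounded_set Q /\
  exists (Psi : set 'rV[R]_4) (c : 'rV[R]_4 -> R),
    Psi `<=` F4_roots /\
    Q = \bigcap_(a in Psi) [set x | dotv a x <= c a].

Definition generating (Sigma P : set 'rV[R]_4) : Prop :=
  [/\ alcoved P, Sigma `<=` P &
      forall Q, alcoved Q -> Sigma `<=` Q -> P `<=` Q].

Definition has_generating_of_size (P : set 'rV[R]_4) (n : nat) : Prop :=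
  exists Sigma, generating Sigma P /\ Sigma #= `I_n.

(* The lower bound ranges over all generating sets, infinite ones included. *)
Definition min_generating_size (P : set 'rV[R]_4) (n : nat) : Prop :=
  has_generating_of_size P n /\
  forall Sigma, generating Sigma P -> `I_n #<= Sigma.

Definition Plm (lambda mu : R) : set 'rV[R]_4 :=
  [set x |
    [/\ forall (s : bool) (i : 'I_4), dotv ((-1) ^+ s *: stdb i) x <= mu,
        forall s : 'I_4 -> bool,
          dotv (\sum_(i < 4) (-1) ^+ (s i) *: stdb i) x <= 2 * mu &
        forall (s t : bool) (i j : 'I_4), (i < j)%N ->
          dotv ((-1) ^+ s *: stdb i + (-1) ^+ t *: stdb j) x <= lambda]].

End F4.

(* Main.v *)
(** A subset of P generates it as soon as it meets every facet hyperplane of P,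
and for a finite subset this is also necessary.  After scaling to mu = 1, the 48
hyperplanes are <s, x> = 1 (s short) and <l, x> = lambda (l long).

Upper bounds: if <s, l> = 1, then (2 - lambda) s + (lambda - 1) l
lies in P and on the hyperplanes of s and l; if s1, s2 (resp. l1, l2) are at 60
degrees and <s_i, l_j> = 1 for all i, j, then
(6 - 4 lambda)(s1 + s2) + (3 lambda - 4)(l1 + l2) lies in P, when
4/3 <= lambda <= 3/2, and on the four hyperplanes of s1, s2, l1, l2.  Writing
the short roots as the Hurwitz unit quaternions, suitable groups of
multiplications of order 24 and 12 act freely on both kinds of roots, and an
orbit of such a point meets all 48 hyperplanes.

Lower bounds: writing the sum of the touched roots as a sum of other roots shows
that a point of P touches at most one long root if lambda > 3/2, at most one
short root if lambda < 4/3, and at most two short roots if lambda < 3/2. *)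

Require Import Defs.
From HB Require Import structures.
From mathcomp Require Import all_boot all_order all_algebra.
From mathcomp Require Import all_classical all_reals all_analysis.
From mathcomp Require Import ring lra.

Set Implicit Arguments.
Unset Strict Implicit.
Unset Printing Implicit Defensive.

Import Order.TTheory GRing.Theory Num.Theory.
Import numFieldNormedType.Exports.

Local Open Scope classical_set_scope.
Local Open Scope card_scope.
Local Open Scope ring_scope.

(** * Cardinality of finite sets, counting, and real inequalities *)

(** An infinite set dominates every [I_n], so only finite sets, enumerated by sequences, need a
    lower bound. *)
Lemma card_ge_seq (T : choiceType) (A : set T) n :
  (forall t : seq T, A = [set` t] -> (n <= size t)%N) -> `I_n #<= A.
Proof.
move=> H; have [finA|infA] := pselect (finite_set A); last first.
  by apply: card_le_trans ((infiniteP A).1 infA); exact: subset_card_le.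
have [m Am] := (finite_setP A).1 finA.
rewrite (card_le_eqr Am) card_le_II.
rewrite -(card_fset_set Am); apply: H; apply/seteqP; split=> x /=.
  by rewrite in_fset_set // => Ax; exact/mem_set.
by rewrite in_fset_set // => /set_mem.
Qed.

Lemma card_set_seq (T : choiceType) (t : seq T) :
  uniq t -> [set` t] #= `I_(size t).
Proof.
move=> ut; have [m tm] := (finite_setP [set` t]).1 (finite_seq t).
suff <- : m = size t by [].
rewrite -(card_fset_set tm); apply/perm_size/uniq_perm => //.
move=> x; rewrite in_fset_set //.
by apply/idP/idP => [/set_mem //|xt]; exact/mem_set.
Qed.

Lemma count_le1 (T : eqType) (a : pred T) (s : seq T) : uniq s ->
  (forall x y, x \in s -> y \in s -> a x -> a y -> x = y) ->
  (count a s <= 1)%N.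
Proof.
move=> us H; rewrite -size_filter; have := filter_uniq a us.
have : forall x, x \in [seq z <- s | a z] -> x \in s /\ a x.
  by move=> x; rewrite mem_filter => /andP[].
case: [seq z <- s | a z] => [|x [|y l]] //= memP.
have [xs ax] : x \in s /\ a x by apply: memP; rewrite !inE eqxx.
have [ys ay] : y \in s /\ a y by apply: memP; rewrite !inE eqxx orbT.
by rewrite (H x y) // inE eqxx.
Qed.

Lemma count_le2 (T : eqType) (a : pred T) (s : seq T) : uniq s ->
  (forall x y z, x \in s -> y \in s -> z \in s -> a x -> a y -> a z ->
     [|| x == y, x == z | y == z]) ->
  (count a s <= 2)%N.
Proof.
move=> us H; rewrite -size_filter; have := filter_uniq a us.
have : forall x, x \in [seq z <- s | a z] -> x \in s /\ a x.
  by move=> x; rewrite mem_filter => /andP[].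
case: [seq z <- s | a z] => [|x [|y [|z l]]] //= memP.
have [xs ax] : x \in s /\ a x by apply: memP; rewrite !inE eqxx.
have [ys ay] : y \in s /\ a y by apply: memP; rewrite !inE eqxx orbT.
have [zs az] : z \in s /\ a z by apply: memP; rewrite !inE eqxx !orbT.
rewrite !inE => /and3P[/norP[xy /norP[xz _]] /norP[yz _] _].
by have := H x y z xs ys zs ax ay az;
  rewrite (negbTE xy) (negbTE xz) (negbTE yz).
Qed.

(** Double counting of the pairs (root, point touching it): every root occurs at least once, every
    point at most [K] times. *)
Lemma size_touched_le (T U : eqType) (t : seq T) (rts : seq U)
    (touch : U -> pred T) (K : nat) :
  (forall r, r \in rts -> has (touch r) t) ->
  (forall p, p \in t -> (count (touch^~ p) rts <= K)%N) ->
  (size rts <= K * size t)%N.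
Proof.
move=> touched few.
have le_sum : (size rts <= \sum_(p <- t) count (touch^~ p) rts)%N.
  elim: rts touched {few} => [//|r s IH] touched /=.
  rewrite big_split /= -add1n leq_add //.
    have -> : (\sum_(p <- t) touch r p)%N = count (touch r) t.
      rewrite -sum1_count [RHS]big_mkcond; apply: eq_bigr => p _.
      by case: (touch r p).
    by rewrite -has_count touched // mem_head.
  by apply: IH => q qs; apply: touched; rewrite inE qs orbT.
apply: leq_trans le_sum _; rewrite big_seq.
apply: (@leq_trans (\sum_(p <- t | p \in t) K)%N); first exact: leq_sum.
by rewrite -big_seq big_const_seq count_predT iter_addn_0.
Qed.

Lemma comb_lt (F : realFieldType) (alpha beta a b c d : F) :
  0 <= alpha -> 0 <= beta -> 0 < alpha + beta -> a < b -> c < d ->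
  alpha * a + beta * c < alpha * b + beta * d.
Proof.
move=> al0 be0 ab0 ab cd; have [al|al] := ltrP 0 alpha.
  by apply: ltr_leD; rewrite ?ltr_pM2l // ler_wpM2l // ltW.
by apply: ler_ltD; rewrite ?ler_wpM2l ?ltr_pM2l //; [exact: ltW|lra].
Qed.

(** Finiteness of [t] yields a uniform slack, which later allows a facet to be pushed inwards. *)
Lemma seq_strict_bound (R : realType) (t : seq 'rV[R]_4) (a : 'rV[R]_4)
    (h : R) :
  (forall p, p \in t -> dotv a p < h) ->
  exists2 M, M < h & forall p, p \in t -> dotv a p <= M.
Proof.
elim: t => [_|p t IH ht]; first by exists (h - 1) => //; lra.
have [|M Mh HM] := IH; first by move=> q qt; apply: ht; rewrite inE qt orbT.
exists (Num.max M (dotv a p)).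
  by rewrite gt_max Mh ht // mem_head.
move=> q; rewrite inE => /orP[/eqP->|/HM qM]; rewrite le_max ?lexx ?orbT //.
by rewrite qM.
Qed.

(** * Roots in doubled integer coordinates *)

(* (a, b, c, d) stands for the vector (a, b, c, d) / 2 of R^4. *)
Definition hvec : Type := (int * int * int * int)%type.

Definition hcoord (v : hvec) (j : nat) : int :=
  let: (a, b, c, d) := v in nth 0 [:: a; b; c; d] j.

Definition hmap2 (f : int -> int -> int) (u v : hvec) : hvec :=
  let: (a, b, c, d) := u in let: (a', b', c', d') := v in
  (f a a', f b b', f c c', f d d').

Definition hadd := hmap2 (fun x y => x + y).
Arguments hadd : simpl never.
Definition hsub := hmap2 (fun x y => x - y).

Definition hdot (u v : hvec) : int :=
  let: (a, b, c, d) := u in let: (a', b', c', d') := v in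
  a * a' + b * b' + c * c' + d * d'.

(* Quaternion product; the halving compensates for the doubled coordinates and
   is exact on the arguments used here. *)
Definition hmul (u v : hvec) : hvec :=
  let: (a, b, c, d) := u in let: (e, f, g, h) := v in
  (((a * e - b * f - c * g - d * h) %/ 2)%Z,
   ((a * f + b * e + c * h - d * g) %/ 2)%Z,
   ((a * g - b * h + c * e + d * f) %/ 2)%Z,
   ((a * h + b * g - c * f + d * e) %/ 2)%Z).

Definition hsgn (s : bool) : int := if s then -1 else 1.

Definition haxis (s : bool) (i : nat) : hvec :=
  let c j : int := if i == j then 2 * hsgn s else 0 in
  (c 0%N, c 1%N, c 2%N, c 3%N).

Definition sign_pairs : seq (bool * bool) :=
  [seq (s, t) | s <- [:: true; false], t <- [:: true; false]].

Definition short1 : seq hvec :=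
  [seq haxis s i | s <- [:: true; false], i <- iota 0 4].

Definition short4 : seq hvec :=
  [seq (hsgn p.1, hsgn p.2, hsgn q.1, hsgn q.2)
     | p <- sign_pairs, q <- sign_pairs].

Definition shorts : seq hvec := short1 ++ short4.

Definition longs : seq hvec :=
  [seq hadd (haxis p.1 q.1) (haxis p.2 q.2) | p <- sign_pairs,
     q <- [:: (0, 1); (0, 2); (0, 3); (1, 2); (1, 3); (2, 3)]%N].

(* Unlike [has], this stops at the first hit under call-by-value evaluation. *)
Definition lazy_has (T : Type) (a : pred T) (s : seq T) : bool :=
  (find a s < size s)%N.

(* If v is a sum of n roots, one of them satisfies n <v, r> >= <v, v>; the test
   prunes the search accordingly. *)
Fixpoint long_sum (n : nat) (v : hvec) : bool :=
  if n is n'.+1 then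
    lazy_has (fun r => if n%:Z * hdot v r < hdot v v then false
                       else long_sum n' (hsub v r)) longs
  else v == (0, 0, 0, 0).

Fixpoint short_sum (n : nat) (v : hvec) : bool :=
  if n is n'.+1 then
    lazy_has (fun r => if n%:Z * hdot v r < hdot v v then false
                       else short_sum n' (hsub v r)) shorts
  else v == (0, 0, 0, 0).

Lemma ord4P (P : 'I_4 -> Prop) :
  P (inord 0) -> P (inord 1) -> P (inord 2) -> P (inord 3) -> forall i, P i.
Proof.
move=> P0 P1 P2 P3 i; rewrite -(inord_val i).
by case: i => [[|[|[|[|//]]]] /= _].
Qed.

Lemma haxis_short (s : bool) (i : 'I_4) : haxis s i \in shorts.
Proof. by case: s; case: i => [[|[|[|[|//]]]] /= _]. Qed.

Lemma half_short (s0 s1 s2 s3 : bool) :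
  (hsgn s0, hsgn s1, hsgn s2, hsgn s3) \in shorts.
Proof. by case: s0; case: s1; case: s2; case: s3. Qed.

Lemma haxis2_long (s t : bool) (i j : 'I_4) :
  (i < j)%N -> hadd (haxis s i) (haxis t j) \in longs.
Proof.
case: i j => [[|[|[|[|//]]]] /= _] [[|[|[|[|//]]]] /= _] // _;
by case: s; case: t.
Qed.

(** * Passage from integer vectors to real vectors *)

Section Embedding.
Variable R : realType.

Definition emb (v : hvec) : 'rV[R]_4 := \row_j ((hcoord v j)%:~R / 2).

Definition hval (v : hvec) (x : 'rV[R]_4) : R := dotv (emb v) x.

Lemma dotvE (u v : 'rV[R]_4) :
  dotv u v = u 0 (inord 0) * v 0 (inord 0) + u 0 (inord 1) * v 0 (inord 1)
    + u 0 (inord 2) * v 0 (inord 2) + u 0 (inord 3) * v 0 (inord 3).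
Proof.
rewrite /dotv !big_ord_recl big_ord0 addr0 !addrA.
by do !congr (_ + _); do !congr (_ * _); congr (_ _ _); apply: val_inj;
  rewrite /= ?inordK.
Qed.

Lemma dotvZl c (u x : 'rV[R]_4) : dotv (c *: u) x = c * dotv u x.
Proof. by rewrite !dotvE !mxE; ring. Qed.

Lemma hvalE v x :
  hval v x = ((hcoord v 0)%:~R * x 0 (inord 0) + (hcoord v 1)%:~R * x 0 (inord 1)
    + (hcoord v 2)%:~R * x 0 (inord 2) + (hcoord v 3)%:~R * x 0 (inord 3)) / 2.
Proof. by rewrite /hval dotvE !mxE !inordK //; ring. Qed.

Lemma hval0 x : hval (0, 0, 0, 0) x = 0.
Proof. by rewrite hvalE /=; ring. Qed.

Lemma hvalD u v x : hval (hadd u v) x = hval u x + hval v x.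
Proof.
case: u v => [[[a b] c] d] [[[a' b'] c'] d'].
by rewrite !hvalE /hadd /= !intrD; ring.
Qed.

Lemma hvalB u v x : hval (hsub u v) x = hval u x - hval v x.
Proof.
case: u v => [[[a b] c] d] [[[a' b'] c'] d'].
by rewrite !hvalE /= !intrB; ring.
Qed.

(** Both arguments have doubled coordinates, hence the 4: squared lengths 1 and 2 become [hdot]
    values 4 and 8. *)
Lemma hval_emb u v : hval u (emb v) = (hdot u v)%:~R / 4.
Proof.
case: u v => [[[a b] c] d] [[[a' b'] c'] d'].
by rewrite hvalE !mxE !inordK //= !intrD !intrM; field.
Qed.

Lemma emb_axis (s : bool) (i : 'I_4) : (-1) ^+ s *: stdb R i = emb (haxis s i).
Proof.
apply/rowP => j; rewrite !mxE eqxx /= -val_eqE.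
by elim/ord4P: i; elim/ord4P: j; rewrite /= !inordK //=; case: s => /=; field.
Qed.

Lemma emb_hadd u v : emb (hadd u v) = emb u + emb v.
Proof.
case: u v => [[[a b] c] d] [[[a' b'] c'] d']; apply/rowP => j.
rewrite !mxE /hadd.
by elim/ord4P: j; rewrite /= !inordK //= intrD; field.
Qed.

Lemma emb_half (s : 'I_4 -> bool) :
  2^-1 *: \sum_(i < 4) (-1) ^+ (s i) *: stdb R i =
  emb (hsgn (s (inord 0)), hsgn (s (inord 1)),
       hsgn (s (inord 2)), hsgn (s (inord 3))).
Proof.
have -> : \sum_(i < 4) (-1) ^+ (s i) *: stdb R i =
    \sum_(i < 4) emb (haxis (s i) i).
  by apply: eq_bigr => i _; exact: emb_axis.
apply/rowP => j; rewrite !mxE summxE.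
have -> : \sum_(i < 4) emb (haxis (s i) i) 0 j = (hsgn (s j))%:~R.
  rewrite (bigD1 j) //= big1 ?addr0 => [|i]; rewrite !mxE -?val_eqE.
    by elim/ord4P: j; rewrite /= !inordK //= intrM; field.
  elim/ord4P: j; elim/ord4P: i; rewrite /= !inordK //= => _; exact: mul0r.
by elim/ord4P: j; rewrite /= !inordK //=; field.
Qed.

Lemma F4_rootsP a : F4_roots a <-> exists2 r, r \in shorts ++ longs & a = emb r.
Proof.
split=> [[[[s [i ->]]|[s [t [i [j [ij ->]]]]]]|[s ->]]|[r + ->]].
- exists (haxis s i); last exact: emb_axis.
  by rewrite mem_cat haxis_short.
- exists (hadd (haxis s i) (haxis t j)); last by rewrite emb_hadd -!emb_axis.
  by rewrite mem_cat haxis2_long // orbT.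
- eexists; last exact: emb_half.
  by rewrite mem_cat half_short.
rewrite mem_cat [r \in shorts]mem_cat -orbA.
move=> /or3P[] /allpairsP[[p q] /= [_ qP ->]].
- left; left; exists p, (inord q).
  by rewrite emb_axis inordK //; move: qP; rewrite !inE => /or4P[]/eqP->.
- right; exists (fun i => nth true [:: p.1; p.2; q.1; q.2] i).
  by rewrite emb_half !inordK.
- left; right; exists p.1, p.2, (inord q.1), (inord q.2).
  rewrite !emb_axis emb_hadd.
  by move: qP; rewrite !inE => /or4P[/eqP->|/eqP->|/eqP->|/or3P[]/eqP->];
    rewrite !inordK.
Qed.

End Embedding.

(** * Supporting hyperplanes of the polytope *)

Section Polytope.
Variables (R : realType) (lambda mu : R).

(** Halving the bound [2 * mu] on full sign sums turns it into the bound [mu] on half sums, so all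
    short roots share one bound. *)
Lemma PlmP (x : 'rV[R]_4) : Plm lambda mu x <->
  (forall r, r \in shorts -> hval r x <= mu) /\
  (forall r, r \in longs -> hval r x <= lambda).
Proof.
have half (s : 'I_4 -> bool) : dotv (\sum_(i < 4) (-1) ^+ (s i) *: stdb R i) x =
    2 * hval (hsgn (s (inord 0)), hsgn (s (inord 1)),
       hsgn (s (inord 2)), hsgn (s (inord 3))) x.
  by rewrite /hval -emb_half dotvZl; field.
split=> [[P1 P4 P2]|[Ps Pl]].
  split=> r; first rewrite mem_cat => /orP[].
  - move=> /allpairsP[[s i] /= [_ i4 ->]].
    have := P1 s (inord i); rewrite emb_axis inordK //.
    by move: i4; rewrite !inE => /or4P[]/eqP->.
  - move=> /allpairsP[[p q] /= [_ _ ->]].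
    have := P4 (fun i => nth true [:: p.1; p.2; q.1; q.2] i).
    by rewrite half !inordK //= ler_pM2l.
  - move=> /allpairsP[[p q] /= [_ qP ->]].
    have := P2 p.1 p.2 (inord q.1) (inord q.2).
    rewrite !emb_axis -emb_hadd.
    by move: qP; rewrite !inE => /or4P[/eqP->|/eqP->|/eqP->|/or3P[]/eqP->];
      rewrite !inordK //; exact.
split=> [s i|s|s t i j ij].
- rewrite emb_axis; apply: Ps; exact: haxis_short.
- rewrite half ler_pM2l //; apply: Ps; exact: half_short.
- rewrite !emb_axis -emb_hadd; apply: Pl; exact: haxis2_long.
Qed.

Definition root_height (a : 'rV[R]_4) : R :=
  if dotv a a == 1 then mu else lambda.

Lemma root_height_short r : r \in shorts -> root_height (emb R r) = mu.
Proof.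
move=> rs; rewrite /root_height -/(hval r _) hval_emb.
have /allP/(_ _ rs)/eqP-> : all (fun u => hdot u u == 4) shorts by [].
by rewrite divff // eqxx.
Qed.

Lemma root_height_long r : r \in longs -> root_height (emb R r) = lambda.
Proof.
move=> rl; rewrite /root_height -/(hval r _) hval_emb.
have /allP/(_ _ rl)/eqP-> : all (fun u => hdot u u == 8) longs by [].
case: eqP => // E; exfalso; lra.
Qed.

Lemma Plm_bigcap :
  Plm lambda mu =
    \bigcap_(a in @F4_roots R) [set x | dotv a x <= root_height a].
Proof.
apply/seteqP; split=> x.
  move=> /PlmP[Ps Pl] a /F4_rootsP[r + ->] /=; rewrite mem_cat => /orP[] rP.
    by rewrite root_height_short //; exact: Ps.
  by rewrite root_height_long //; exact: Pl.
move=> Px; apply/PlmP; split=> r rP.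
  rewrite -(root_height_short rP); apply: Px; apply/F4_rootsP.
  by exists r => //; rewrite mem_cat rP.
rewrite -(root_height_long rP); apply: Px; apply/F4_rootsP.
by exists r => //; rewrite mem_cat rP orbT.
Qed.

Lemma bounded_Plm : bounded_set (Plm lambda mu).
Proof.
exists mu; split; first exact: num_real.
move=> M muM x [P1 _ _] /=.
have le_coord i : `|x 0 i| <= mu.
  have := P1 false i; have := P1 true i.
  rewrite ler_norml !dotvZl.
  have -> : dotv (stdb R i) x = x 0 i.
    rewrite /dotv (bigD1 i) //= big1 => [|j ji]; rewrite !mxE ?eqxx //=.
      by rewrite addr0 mul1r.
    by rewrite (negbTE ji) mul0r.
  by move=> /= h1 h2; apply/andP; split; lra.
(* The sign of [mu] is not assumed here; a point of the polytope forces it. *)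
have mu0 : 0 <= mu by apply: le_trans (le_coord 0).
rewrite [`|x|]/(mx_norm x) /mx_norm.
apply: le_trans (ltW muM).
rewrite -[mu]/((NngNum mu0)%:num) num_le.
apply: bigmax_le => [|[i j] _ /=]; first exact: mu0.
by rewrite -num_le /= (ord1 i).
Qed.

Lemma alcoved_Plm : alcoved (Plm lambda mu).
Proof.
split; first exact: bounded_Plm.
by exists (@F4_roots R), root_height; split=> //; exact: Plm_bigcap.
Qed.

(** If no point of [t] met the hyperplane of [a], lowering the bound for [a] to [M] would give a
    smaller alcoved polytope that contains [t] but misses [p0]. *)
Lemma generating_touches (t : seq 'rV[R]_4) (a p0 : 'rV[R]_4) :
  generating [set` t] (Plm lambda mu) -> F4_roots a ->
  Plm lambda mu p0 -> dotv a p0 = root_height a ->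
  exists2 p, p \in t & dotv a p = root_height a.
Proof.
move=> [_ tP tmin] aroot p0P p0a; apply: contrapT => no_touch.
have Plt p : p \in t -> dotv a p < root_height a.
  move=> pt; rewrite lt_neqAle; apply/andP; split.
    by apply/eqP => e; apply: no_touch; exists p.
  by have := tP p pt; rewrite Plm_bigcap; exact.
have [M Ma tM] := seq_strict_bound Plt.
pose c b := if b == a then M else root_height b.
pose Q := \bigcap_(b in @F4_roots R) [set x | dotv b x <= c b].
have QP : Q `<=` Plm lambda mu.
  move=> x Qx; rewrite Plm_bigcap => b br; have /= := Qx b br.
  by rewrite /c; case: eqP => // -> /le_trans; apply; exact: ltW.
have : Plm lambda mu `<=` Q.
  apply: tmin; first split.
  - apply: (sub_boundedr (G := globally (Plm lambda mu))) bounded_Plm.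
    by move=> A PA x /QP; exact: PA.
  - by exists (@F4_roots R), c; split.
  move=> p pt b br /=; rewrite /c; case: eqP => [->|_]; first exact: tM.
  by have := tP p pt; rewrite Plm_bigcap; exact.
move=> /(_ _ p0P _ aroot) /=; rewrite p0a /c eqxx => /le_lt_trans/(_ Ma).
by rewrite ltxx.
Qed.

(** Each of the [n] long roots summing to [v] takes a value at most [lambda] on the polytope. *)
Lemma long_sum_le n v x :
  long_sum n v -> Plm lambda mu x -> hval v x <= n%:R * lambda.
Proof.
move=> + /PlmP[_ Pl]; elim: n v => [|n IHn] v.
  by move=> /eqP->; rewrite hval0 mul0r.
rewrite [long_sum _ _]/(lazy_has _ _) /lazy_has -has_find => /hasP[r /Pl rx].
by case: ifP => // _ /IHn; rewrite hvalB -(natr1 n); lra.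
Qed.

Lemma short_sum_le n v x :
  short_sum n v -> Plm lambda mu x -> hval v x <= n%:R * mu.
Proof.
move=> + /PlmP[Ps _]; elim: n v => [|n IHn] v.
  by move=> /eqP->; rewrite hval0 mul0r.
rewrite [short_sum _ _]/(lazy_has _ _) /lazy_has -has_find => /hasP[r /Ps rx].
by case: ifP => // _ /IHn; rewrite hvalB -(natr1 n); lra.
Qed.

End Polytope.

(** * Tables of points and root identities checked by computation *)

(* (q, q (1 + i)) for q a Hurwitz unit. *)
Definition pair24 : seq (hvec * hvec) :=
  [seq (q, hmul q (2, 2, 0, 0)) | q <- shorts].

(* The orbit under x |-> i^m x w^n, w = (-1 + i + j + k) / 2, of
   (s1 + s2, l1 + l2) with s1 = 1, s2 = (1 + i - j + k) / 2, l1 = 1 + i, l2 = 1 - j. *)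
Definition pair12 : seq (hvec * hvec) :=
  [seq (hmul (hmul a (3, 1, -1, 1)) b, hmul (hmul a (4, 2, -2, 0)) b)
     | a <- [:: (2, 0, 0, 0); (0, 2, 0, 0); (-2, 0, 0, 0); (0, -2, 0, 0)],
       b <- [:: (2, 0, 0, 0); (-1, 1, 1, 1); (-1, -1, -1, -1)]].

(** Bounding the two components separately keeps the check independent of the real coefficients; a
    root whose bounds are both attained by one [k] is touched by its point. *)
Definition touching_values (rts : seq hvec) (tab : seq (hvec * hvec))
    (A B : int) : bool :=
  all (fun r => all (fun k => (hdot r k.1 <= A) && (hdot r k.2 <= B)) tab
             && has (fun k => (hdot r k.1 == A) && (hdot r k.2 == B)) tab) rts.

(* For k <> l the vector k.1 + k.2 separates alpha k.1 + beta k.2 from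
   alpha l.1 + beta l.2, whatever alpha, beta >= 0 not both zero. *)
Definition separated (tab : seq (hvec * hvec)) : bool :=
  uniq tab &&
  all (fun k => all (fun l => (k == l) ||
    (hdot (hadd k.1 k.2) l.1 < hdot (hadd k.1 k.2) k.1) &&
    (hdot (hadd k.1 k.2) l.2 < hdot (hadd k.1 k.2) k.2)) tab) tab.

Lemma pair24_short : touching_values shorts pair24 4 4.
Proof. by vm_compute. Qed.
Lemma pair24_long : touching_values longs pair24 4 8.
Proof. by vm_compute. Qed.
Lemma pair24_separated : separated pair24.
Proof. by vm_compute. Qed.
Lemma pair12_short : touching_values shorts pair12 6 8.
Proof. by vm_compute. Qed.
Lemma pair12_long : touching_values longs pair12 8 12.
Proof. by vm_compute. Qed.
Lemma pair12_separated : separated pair12.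
Proof. by vm_compute. Qed.

(** Cases by angle: at 60 degrees [2 (u + v)] is a sum of three long roots; at 180, 120 and 90
    degrees [u + v] is zero, short and long respectively. *)
Definition short_pair_bounded (u v : hvec) : bool :=
  let w := hadd u v in
  if u == v then true else
  if hdot u v == 2 then long_sum 3 (hadd w w) else
  if short_sum 0 w then true else
  if short_sum 1 w then true else long_sum 1 w.

(** At 120 degrees the sum is a long root, at 90 a sum of two short roots, at 60 a sum of three.
    Opposite roots fall under [short_sum 2], as zero is [r + (- r)]. *)
Definition long_pair_bounded (u v : hvec) : bool :=
  let w := hadd u v in
  if u == v then true else
  if long_sum 1 w then true else
  if short_sum 2 w then true else short_sum 3 w.

Definition short_triple_bounded (u v w : hvec) : bool :=
  if (hdot u v == 2) && (hdot u w == 2) && (hdot v w == 2)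
  then long_sum 2 (hadd (hadd u v) w) else true.

Lemma short_pairs : all (fun u => all (short_pair_bounded u) shorts) shorts.
Proof. by vm_compute. Qed.

Lemma long_pairs : all (fun u => all (long_pair_bounded u) longs) longs.
Proof. by vm_compute. Qed.

Lemma short_triples :
  all (fun u => all (fun v => all (short_triple_bounded u v) shorts) shorts)
    shorts.
Proof. by vm_compute. Qed.

(** * Generating sets built from the tables *)

Section Generators.
Variables (R : realType) (lambda mu : R).
Notation P := (Plm lambda mu).

Section Table.
Variables (tab : seq (hvec * hvec)) (alpha beta : R) (A B C D : int).
Hypotheses (alpha_ge0 : 0 <= alpha) (beta_ge0 : 0 <= beta).
Hypothesis alpha_beta : 0 < alpha + beta.
Hypotheses (short_ok : touching_values shorts tab A B)
           (long_ok : touching_values longs tab C D).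
Hypotheses (muE : alpha * A%:~R + beta * B%:~R = 4 * mu)
           (lambdaE : alpha * C%:~R + beta * D%:~R = 4 * lambda).

Definition gen_point (k : hvec * hvec) : 'rV[R]_4 :=
  alpha *: emb R k.1 + beta *: emb R k.2.

Lemma hval_gen_point r k :
  hval r (gen_point k) =
  (alpha * (hdot r k.1)%:~R + beta * (hdot r k.2)%:~R) / 4.
Proof.
have -> : hval r (gen_point k) =
    alpha * hval r (emb R k.1) + beta * hval r (emb R k.2).
  by rewrite !hvalE !mxE; field.
by rewrite !hval_emb; field.
Qed.

Lemma touching_le rts E F h r k : touching_values rts tab E F ->
  alpha * E%:~R + beta * F%:~R = 4 * h ->
  r \in rts -> k \in tab -> hval r (gen_point k) <= h.
Proof.
move=> /allP ok hE /ok/andP[/allP le _] /le/andP[le1 le2].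
rewrite hval_gen_point ler_pdivrMr // [h * 4]mulrC -hE.
by apply: lerD; apply: ler_wpM2l => //; rewrite ler_int.
Qed.

Lemma touching_eq rts E F h r : touching_values rts tab E F ->
  alpha * E%:~R + beta * F%:~R = 4 * h ->
  r \in rts -> exists2 k, k \in tab & hval r (gen_point k) = h.
Proof.
move=> /allP ok hE /ok/andP[_ /hasP[k kt /andP[/eqP e1 /eqP e2]]].
by exists k => //; rewrite hval_gen_point e1 e2 hE; field.
Qed.

Lemma gen_point_Plm k : k \in tab -> P (gen_point k).
Proof.
move=> kt; apply/PlmP; split=> r rP.
  exact: touching_le short_ok muE rP kt.
exact: touching_le long_ok lambdaE rP kt.
Qed.

Lemma gen_point_touches a : F4_roots a ->
  exists2 k, k \in tab & dotv a (gen_point k) = root_height lambda mu a.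
Proof.
move=> /F4_rootsP[r + ->]; rewrite mem_cat => /orP[] rP.
  by rewrite root_height_short //; exact: touching_eq short_ok muE rP.
by rewrite root_height_long //; exact: touching_eq long_ok lambdaE rP.
Qed.

Lemma gen_point_inj : separated tab -> {in tab &, injective gen_point}.
Proof.
move=> /andP[_ /allP sep] k l kt lt e.
have /allP/(_ _ lt)/orP[/eqP//|/andP[lt1 lt2]] := sep _ kt.
move: lt1 lt2; rewrite -2!(ltr_int R) => lt1 lt2.
have := congr1 (fun x => hval (hadd k.1 k.2) x * 4) e.
rewrite !hval_gen_point !divfK // => e4.
by have := comb_lt alpha_ge0 beta_ge0 alpha_beta lt1 lt2; rewrite e4 ltxx.
Qed.

(** Every root hyperplane contains a generated point, so each bound [c a] of an alcoved set
    containing these points is at least the height of [a]. *)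
Lemma generating_gen_points : generating [set` [seq gen_point k | k <- tab]] P.
Proof.
split; first exact: alcoved_Plm.
  by move=> x /mapP[k kt ->]; exact: gen_point_Plm.
move=> Q [_ [Psi [c [Psi_roots ->]]]] SQ x; rewrite Plm_bigcap => Px a aPsi /=.
have [k kt e] := gen_point_touches (Psi_roots _ aPsi).
apply: le_trans (Px a (Psi_roots _ aPsi)) _; rewrite -e.
by apply: SQ => //=; apply/mapP; exists k.
Qed.

Lemma has_generating_table :
  separated tab -> has_generating_of_size P (size tab).
Proof.
move=> sep; exists [set` [seq gen_point k | k <- tab]]; split.
  exact: generating_gen_points.
have -> : size tab = size [seq gen_point k | k <- tab] by rewrite size_map.
apply: card_set_seq; rewrite map_inj_in_uniq; first by case/andP: sep.
exact: gen_point_inj.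
Qed.

End Table.

(** With [coeff24_lambda], the coefficients solve a 2 by 2 linear system; they are nonnegative
    exactly when [mu <= lambda <= 2 * mu]. *)
Lemma coeff24_mu : (2 * mu - lambda) * 4%:~R + (lambda - mu) * 4%:~R = 4 * mu.
Proof. ring. Qed.

Lemma coeff24_lambda :
  (2 * mu - lambda) * 4%:~R + (lambda - mu) * 8%:~R = 4 * lambda.
Proof. ring. Qed.

(** Likewise for the second table; nonnegativity now means [4 / 3 * mu <= lambda <= 3 / 2 * mu]. *)
Lemma coeff12_mu :
  (6 * mu - 4 * lambda) * 6%:~R + (3 * lambda - 4 * mu) * 8%:~R = 4 * mu.
Proof. ring. Qed.

Lemma coeff12_lambda :
  (6 * mu - 4 * lambda) * 8%:~R + (3 * lambda - 4 * mu) * 12%:~R = 4 * lambda.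
Proof. ring. Qed.

Hypothesis range : [/\ 0 < mu, mu <= lambda & lambda <= 2 * mu].

Lemma has_generating24 : has_generating_of_size P 24.
Proof.
have [mu0 mul lam2] := range.
by apply: (has_generating_table _ _ _ pair24_short pair24_long coeff24_mu
  coeff24_lambda pair24_separated); lra.
Qed.

Lemma has_generating12 : 4 / 3 * mu <= lambda <= 3 / 2 * mu ->
  has_generating_of_size P 12.
Proof.
have [mu0 mul lam2] := range; move=> /andP[h1 h2].
by apply: (has_generating_table _ _ _ pair12_short pair12_long coeff12_mu
  coeff12_lambda pair12_separated); lra.
Qed.

(** The 24-point table serves on the whole range of [lambda], so it shows that each of the 48
    inequalities is tight somewhere on [P]. *)
Lemma root_touched a : F4_roots a ->
  exists2 p, P p & dotv a p = root_height lambda mu a.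
Proof.
have [mu0 mul lam2] := range; move=> aroot.
have [k kt e] := gen_point_touches pair24_short pair24_long coeff24_mu
  coeff24_lambda aroot.
exists (gen_point (2 * mu - lambda) (lambda - mu) k) => //.
by apply: (gen_point_Plm _ _ pair24_short pair24_long coeff24_mu coeff24_lambda)
  => //; lra.
Qed.

Lemma shorts_touched (t : seq 'rV[R]_4) r : generating [set` t] P ->
  r \in shorts -> has (fun p => hval r p == mu) t.
Proof.
move=> gen rs; have rroot : F4_roots (emb R r).
  by apply/F4_rootsP; exists r => //; rewrite mem_cat rs.
have [p0 p0P p0r] := root_touched rroot.
have [p pt pr] := generating_touches gen rroot p0P p0r.
by apply/hasP; exists p => //; rewrite /hval pr root_height_short.
Qed.

Lemma longs_touched (t : seq 'rV[R]_4) r : generating [set` t] P ->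
  r \in longs -> has (fun p => hval r p == lambda) t.
Proof.
move=> gen rl; have rroot : F4_roots (emb R r).
  by apply/F4_rootsP; exists r => //; rewrite mem_cat rl orbT.
have [p0 p0P p0r] := root_touched rroot.
have [p pt pr] := generating_touches gen rroot p0P p0r.
by apply/hasP; exists p => //; rewrite /hval pr root_height_long.
Qed.

(** * Lower bounds from how many roots a point can touch *)

Lemma short_touching_eq p u v : P p -> lambda < 4 / 3 * mu ->
  u \in shorts -> v \in shorts -> hval u p = mu -> hval v p = mu -> u = v.
Proof.
have [mu0 mul lam2] := range; move=> Pp lm us vs uE vE.
have /allP/(_ _ us)/allP/(_ _ vs) := short_pairs; rewrite /short_pair_bounded.
have := hvalD u v p; rewrite uE vE; set w := hadd u v => wE.
case: eqP => // _; case: ifP => _.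
  (* The 60-degree case would give [4 * mu <= 3 * lambda]. *)
  by move=> /long_sum_le/(_ Pp); rewrite hvalD => ?; exfalso; lra.
case: ifP => [/short_sum_le/(_ Pp) ?|_]; first by exfalso; lra.
case: ifP => [/short_sum_le/(_ Pp) ?|_]; first by exfalso; lra.
by move=> /long_sum_le/(_ Pp) ?; exfalso; lra.
Qed.

Lemma long_touching_eq p u v : P p -> 3 / 2 * mu < lambda ->
  u \in longs -> v \in longs -> hval u p = lambda -> hval v p = lambda -> u = v.
Proof.
have [mu0 mul lam2] := range; move=> Pp lm us vs uE vE.
have /allP/(_ _ us)/allP/(_ _ vs) := long_pairs; rewrite /long_pair_bounded.
have := hvalD u v p; rewrite uE vE; set w := hadd u v => wE.
case: eqP => // _.
(* The three cases would bound [2 * lambda] by [lambda], [2 * mu] and [3 * mu]. *)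
case: ifP => [/long_sum_le/(_ Pp) ?|_]; first by exfalso; lra.
case: ifP => [/short_sum_le/(_ Pp) ?|_]; first by exfalso; lra.
by move=> /short_sum_le/(_ Pp) ?; exfalso; lra.
Qed.

(** Any other angle between distinct roots would bound [2 * mu] by [0], [mu] or [lambda]. *)
Lemma short_touching_angle p u v : P p -> lambda < 2 * mu ->
  u \in shorts -> v \in shorts -> hval u p = mu -> hval v p = mu ->
  u != v -> hdot u v = 2.
Proof.
have [mu0 mul lam2] := range; move=> Pp lm us vs uE vE.
have /allP/(_ _ us)/allP/(_ _ vs) := short_pairs; rewrite /short_pair_bounded.
have := hvalD u v p; rewrite uE vE; set w := hadd u v => wE.
case: eqP => // _; case: eqP => // _.
case: ifP => [/short_sum_le/(_ Pp) ?|_]; first by exfalso; lra.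
case: ifP => [/short_sum_le/(_ Pp) ?|_]; first by exfalso; lra.
by move=> /long_sum_le/(_ Pp) ?; exfalso; lra.
Qed.

Lemma short_touching_triple p u v w : P p -> lambda < 3 / 2 * mu ->
  u \in shorts -> v \in shorts -> w \in shorts ->
  hval u p = mu -> hval v p = mu -> hval w p = mu ->
  [|| u == v, u == w | v == w].
Proof.
have [mu0 mul lam2] := range.
move=> Pp lm us vs ws uE vE wE; apply: contraT => /norP[uv /norP[uw vw]].
have lm2 : lambda < 2 * mu by lra.
have /allP/(_ _ us)/allP/(_ _ vs)/allP/(_ _ ws) := short_triples.
rewrite /short_triple_bounded !(short_touching_angle Pp lm2) // eqxx.
(* Three roots pairwise at 60 degrees sum to two long roots, forcing [3 * mu <= 2 * lambda]. *)
by move=> /long_sum_le/(_ Pp); rewrite !hvalD uE vE wE; lra.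
Qed.

Lemma min_generating_card n :
  has_generating_of_size P n ->
  (forall t : seq 'rV[R]_4, generating [set` t] P -> (n <= size t)%N) ->
  min_generating_size P n.
Proof.
move=> has_n lower; split=> // Sigma gen; apply: card_ge_seq => t tE.
by apply: lower; rewrite -tE.
Qed.

Lemma min_generating12 : 4 / 3 * mu < lambda < 3 / 2 * mu ->
  min_generating_size P 12.
Proof.
move=> /andP[h1 h2]; apply: min_generating_card => [|t gen].
  by apply: has_generating12; rewrite !ltW.
(* There are 24 short roots and each point touches at most two, so the goal is doubled to
   [24 <= 2 * size t]. *)
rewrite -(leq_pmul2l (isT : (0 < 2)%N)) -[(2 * 12)%N]/(size shorts).
apply: (size_touched_le (touch := fun r p => hval r p == mu)) => [r rs|p pt].
  exact: shorts_touched.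
apply: count_le2 => [//|u v w us vs ws /eqP uE /eqP vE /eqP wE].
have [_ tP _] := gen; exact: (short_touching_triple (tP p pt)).
Qed.

Lemma min_generating24 :
  (mu < lambda < 4 / 3 * mu) \/ (3 / 2 * mu < lambda < 2 * mu) ->
  min_generating_size P 24.
Proof.
move=> h; apply: min_generating_card has_generating24 _ => t gen.
have [_ tP _] := gen; rewrite -[size t]mul1n; case: h => /andP[h1 h2].
  (* For small [lambda] the 24 short roots need distinct points; for large [lambda] the 24 long
     roots do. *)
  rewrite -[24%N]/(size shorts).
  apply: (size_touched_le (touch := fun r p => hval r p == mu)) => [r rs|p pt].
    exact: shorts_touched.
  apply: count_le1 => // u v us vs /eqP uE /eqP vE.
  exact: (short_touching_eq (tP p pt)).
rewrite -[24%N]/(size longs).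
apply: (size_touched_le (touch := fun r p => hval r p == lambda))
  => [r rs|p pt].
  exact: longs_touched.
apply: count_le1 => // u v us vs /eqP uE /eqP vE.
exact: (long_touching_eq (tP p pt)).
Qed.

End Generators.

Theorem theorem4p6 (R : realType) (lambda mu : R)
    (lambda_gt0 : 0 < lambda) (mu_gt0 : 0 < mu)
    (mu_le_lambda : mu <= lambda) (lambda_le_2mu : lambda <= 2 * mu) :
  [/\ 4 / 3 * mu <= lambda <= 3 / 2 * mu ->
        has_generating_of_size (Plm lambda mu) 12,
      (mu <= lambda <= 4 / 3 * mu) \/ (3 / 2 * mu <= lambda <= 2 * mu) ->
        has_generating_of_size (Plm lambda mu) 24,
      4 / 3 * mu < lambda < 3 / 2 * mu ->
        min_generating_size (Plm lambda mu) 12 &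
      (mu < lambda < 4 / 3 * mu) \/ (3 / 2 * mu < lambda < 2 * mu) ->
        min_generating_size (Plm lambda mu) 24].
Proof.
have range : [/\ 0 < mu, mu <= lambda & lambda <= 2 * mu] by [].
split.
- exact: has_generating12.
- by move=> _; exact: has_generating24.
- exact: min_generating12.
- exact: min_generating24.
Qed.
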